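(* Let $A_1A_2A_3A_4$ be a quadrilateral inscribed in a nondegenerate conic $\mathcal{C}$, and let the points $J_1,\dots,J_8$ be as defined in the context (in general position as specified there). For $i=1,\dots,8$ let $K_i$ be the intersection point of the lines $J_iJ_{i+1}$ and $J_{i+2}J_{i+3}$ (indices modulo $8$). Then the points $K_1,\dots,K_8$ all lie on the same conic.
   Context: The ambient plane is the complex projective plane (real configurations being included), and $A_1,A_2,A_3,A_4$ are four distinct points of the nondegenerate conic $\mathcal{C}$. A conic is the zero locus of a nonzero homogeneous quadratic form. Let $t_i$ be the tangent line to $\mathcal{C}$ at $A_i$. Let $T_1=A_3A_4\cap t_1$, $T_2=A_4A_1\cap t_2$, $T_3=A_1A_2\cap t_3$, $T_4=A_2A_3\cap t_4$, and $X_1=A_2A_3\cap t_1$, $X_2=A_3A_4\cap t_2$, $X_3=A_4A_1\cap t_3$, $X_4=A_1A_2\cap t_4$. The eight points $X_1,\dots,X_4,T_1,\dots,T_4$ lie on one conic, denoted $\mathcal{C}_1$. For $i=1,2,3,4$, let $J_{2i-1}$ be the intersection point of the tangent lines to $\mathcal{C}_1$ at $X_{i-2}$ and $T_i$, and let $J_{2i}$ be the intersection point of the tangent lines to $\mathcal{C}_1$ at $X_{i-1}$ and $T_i$ (indices of $X$ modulo $4$, in $\{1,2,3,4\}$). Explicitly, $J_1,\dots,J_8$ are the intersection points of the tangents to $\mathcal{C}_1$ at the pairs $(X_3,T_1)$, $(X_4,T_1)$, $(X_4,T_2)$, $(X_1,T_2)$, $(X_1,T_3)$, $(X_2,T_3)$,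 $(X_2,T_4)$, $(X_3,T_4)$ respectively. General position: the points $X_1,\dots,X_4,T_1,\dots,T_4$ are pairwise distinct, $\mathcal{C}_1$ is nondegenerate, and all points and lines named in the claim are well defined. *)

(* Defs.v *)
From mathcomp Require Import all_boot all_algebra.
From mathcomp Require Import complex reals.

Set Implicit Arguments.
Unset Strict Implicit.
Unset Printing Implicit Defensive.

Import GRing.Theory.

Local Open Scope ring_scope.

(* The projective plane over F: points are the 1-dimensional subspaces of F^3,
   lines are the 2-dimensional ones. The join of two distinct points is their
   sum, the intersection point of two distinct lines is their intersection. *)

Definition is_point (F : fieldType) (P : {vspace 'rV[F]_3}) : Prop :=
  \dim P = 1%N.

Definition is_line (F : fieldType) (L : {vspace 'rV[F]_3}) : Prop :=
  \dim L = 2%N.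

Definition line_through (F : fieldType) (P Q : {vspace 'rV[F]_3}) :
    {vspace 'rV[F]_3} :=
  (P + Q)%VS.

(* The conditions on L and M say that the intersection point is well defined. *)
Definition intersection_point (F : fieldType)
    (L M P : {vspace 'rV[F]_3}) : Prop :=
  [/\ is_line L, is_line M, L != M & P = (L :&: M)%VS].

(* A nonzero ternary quadratic form v |-> v *m A *m v^T, given by its symmetric
   matrix A; this covers all quadratic forms as soon as 2 != 0 in F. *)
Record conic (F : fieldType) := Conic {
  conic_mx :> 'M[F]_3;
  conic_sym : conic_mx^T = conic_mx;
  conic_neq0 : conic_mx != 0
}.

Definition quad_form (F : fieldType) (C : conic F) (v : 'rV[F]_3) : F :=
  (v *m C *m v^T) 0 0.

Definition on_conic (F : fieldType) (C : conic F)
    (P : {vspace 'rV[F]_3}) : Prop :=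
  forall v, v \in P -> quad_form C v = 0.

Definition nondegenerate_conic (F : fieldType) (C : conic F) : Prop :=
  conic_mx C \in unitmx.

(* The differential of quad_form C at v is w |-> 2 (w *m C *m v^T), so this is
   the tangent line at P when P is a point of C at which C is smooth. For such
   a P, the kernel does not depend on the nonzero vector vpick P chosen in P. *)
Definition tangent (F : fieldType) (C : conic F) (P : {vspace 'rV[F]_3}) :
    {vspace 'rV[F]_3} :=
  lker (linfun (fun w : 'rV[F]_3 => w *m (C *m (vpick P)^T))).

(* The class of 2i modulo 8, for i an integer modulo 4. *)
Definition double8 (i : 'Z_4) : 'Z_8 := (i.*2)%:R.

(* Main.v *)
(* The points J_(2i-1), J_(2i) lie on the tangent to C1 at T_i, and J_(2i),
   J_(2i+1) on the one at X_(i-1), so K_(2i-1) and K_(2i) are the poles with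
   respect to C1 of the lines T_i T_(i+1) and X_(i-1) X_i. Hence the K's lie on a
   conic as soon as these eight lines belong to a common dual conic, which is a
   fact about C and the A's alone. In the projective frame A_1 = (1:0:0),
   A_2 = (0:1:0), A_3 = (0:0:1), A_4 = (1:1:1), the conic C is
   a yz + b xz + c xy = 0 with a + b + c = 0 and abc != 0, and the dual conic has
   an explicit matrix with entries quartic in a and b. *)

Require Import Defs.
From mathcomp Require Import all_boot all_algebra.
From mathcomp Require Import complex reals.
From mathcomp Require Import ring.

Import GRing.Theory.
Local Open Scope ring_scope.

Set Implicit Arguments.
Unset Strict Implicit.
Unset Printing Implicit Defensive.

(** * Dot and cross products in coordinates *)

Definition dot (F : fieldType) (u v : 'rV[F]_3) : F := (u *m v^T) 0 0.

Definition vec3 (F : fieldType) (x y z : F) : 'rV[F]_3 :=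
  \row_j [:: x; y; z]`_j.

(** For distinct points this is the coordinate vector of the line joining them, with [dot] as the
    incidence pairing. *)
Definition cross (F : fieldType) (u v : 'rV[F]_3) : 'rV[F]_3 :=
  vec3 (u 0 1 * v 0 2 - u 0 2 * v 0 1) (u 0 2 * v 0 0 - u 0 0 * v 0 2)
       (u 0 0 * v 0 1 - u 0 1 * v 0 0).

Lemma vec3_ext (F : fieldType) (u v : 'rV[F]_3) :
  u 0 0 = v 0 0 -> u 0 1 = v 0 1 -> u 0 2 = v 0 2 -> u = v.
Proof.
move=> h0 h1 h2; apply/rowP => -[[|[|[|//]]] lt_j3].
- by move: h0; congr (u 0 _ = v 0 _); apply/val_inj.
- by move: h1; congr (u 0 _ = v 0 _); apply/val_inj.
- by move: h2; congr (u 0 _ = v 0 _); apply/val_inj.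
Qed.

Lemma vec3E (F : fieldType) (x y z : F) :
  ((vec3 x y z 0 0 = x) * (vec3 x y z 0 1 = y) * (vec3 x y z 0 2 = z))%type.
Proof. by rewrite !mxE. Qed.

Lemma sum_ord3 (V : nmodType) (f : 'I_3 -> V) :
  \sum_i f i = f 0 + f 1 + f 2.
Proof.
rewrite !big_ord_recl big_ord0 addr0 addrA.
by congr (f _ + f _ + f _); apply/val_inj.
Qed.

Lemma dotE (F : fieldType) (u v : 'rV[F]_3) :
  dot u v = u 0 0 * v 0 0 + u 0 1 * v 0 1 + u 0 2 * v 0 2.
Proof. by rewrite /dot mxE sum_ord3 !mxE. Qed.

Lemma dotDl (F : fieldType) (u v w : 'rV[F]_3) :
  dot (u + v) w = dot u w + dot v w.
Proof. by rewrite /dot mulmxDl mxE. Qed.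

Lemma dotZl (F : fieldType) k (u w : 'rV[F]_3) : dot (k *: u) w = k * dot u w.
Proof. by rewrite /dot -scalemxAl mxE. Qed.

Lemma dotC (F : fieldType) (u v : 'rV[F]_3) : dot u v = dot v u.
Proof. by rewrite !dotE; ring. Qed.

Lemma dot_mulmx (F : fieldType) (M : 'M[F]_3) (u v : 'rV[F]_3) :
  dot u (v *m M) = dot (u *m M^T) v.
Proof. by rewrite /dot trmx_mul mulmxA. Qed.

Lemma ord3_cases (Q : 'I_3 -> Prop) : Q 0 -> Q 1 -> Q 2 -> forall i, Q i.
Proof.
by move=> Q0 Q1 Q2 [[|[|[|//]]] lt_i3]; [move: Q0|move: Q1|move: Q2];
  congr Q; apply/val_inj.
Qed.

(** All 2 by 2 minors of the pair vanish, so the ratio at any nonzero coordinate of [v] is the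
    common factor. *)
Lemma cross_eq0 (F : fieldType) (u v : 'rV[F]_3) :
  v != 0 -> cross u v = 0 -> exists k, u = k *: v.
Proof.
move=> v_neq0 /rowP uv0.
have := uv0 0; have := uv0 1; have := uv0 2; rewrite !vec3E !mxE.
move=> /subr0_eq e2 /subr0_eq e1 /subr0_eq e0.
have uvC i j : u 0 i * v 0 j = u 0 j * v 0 i.
  by elim/ord3_cases: i; elim/ord3_cases: j.
have /rV0Pn [i vi_neq0] := v_neq0.
exists (u 0 i / v 0 i); apply/rowP => j.
by rewrite mxE mulrAC uvC mulfK.
Qed.

(** By the triple product expansion, the cross product of [y] with [cross u v] is a combination of
    [u] and [v] with coefficients [dot y v] and [- dot y u]. *)
Lemma orth_cross (F : fieldType) (u v y : 'rV[F]_3) : cross u v != 0 ->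
  dot y u = 0 -> dot y v = 0 -> exists k, y = k *: cross u v.
Proof.
move=> uv_neq0 yu0 yv0; apply: cross_eq0 => //.
have -> : cross y (cross u v) = dot y v *: u - dot y u *: v.
  by apply: vec3_ext; rewrite !(vec3E, dotE, mxE); ring.
by rewrite yu0 yv0 !scale0r subr0.
Qed.

(** * Tangents, intersection points and isotropic vectors *)

Lemma mem_tangent (F : fieldType) (C : conic F) P w :
  (w \in tangent C P) = (dot (w *m C) (vpick P) == 0).
Proof.
rewrite /tangent.
(* The two functions are convertible, and [mulmxr] carries the linear structure that [lfunE]
   requires. *)
have -> : linfun (fun w : 'rV[F]_3 => w *m (C *m (vpick P)^T))
          = linfun (mulmxr (C *m (vpick P)^T)) by [].
rewrite memv_ker lfunE /= /dot mulmxA; apply/eqP/eqP => [->|h]; first by rewrite mxE.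
by apply/rowP => i; rewrite ord1 h mxE.
Qed.

(** Two planes in a space of dimension 3 cannot meet in zero, since 2 + 2 > 3. *)
Lemma intersection_point_neq0 (F : fieldType) (L M P : {vspace 'rV[F]_3}) :
  intersection_point L M P -> P != 0%VS.
Proof.
move=> [dL dM _ ->]; apply/eqP => LM0.
have := dimv_sum_cap L M; rewrite LM0 dimv0 dL dM addn0 => dLM.
by have := dimvS (subvf (L + M)); rewrite dLM dimvf dim_matrix.
Qed.

(** The intersection is nonzero, so a one-dimensional space containing it is equal to it; one
    inclusion is enough to compute the point. *)
Lemma intersection_point_line (F : fieldType) (L M P : {vspace 'rV[F]_3}) t :
  intersection_point L M P ->
  (forall w, w \in L -> w \in M -> exists k, w = k *: t) ->
  P = <[t]>%VS.
Proof.
move=> LMP LMt; have P_neq0 := intersection_point_neq0 LMP.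
have [_ _ _ defP] := LMP.
have := memv_pick P; rewrite {2}defP memv_cap => /andP[PL PM].
have [k Pk] := LMt _ PL PM.
have k_neq0 : k != 0.
  by apply: contraNneq P_neq0 => k0; rewrite -vpick0 Pk k0 scale0r.
apply/eqP; rewrite eqEsubv; apply/andP; split; apply/subvP => w.
  by rewrite defP memv_cap => /andP[wL wM]; apply/vlineP/LMt.
move=> /vlineP[l ->]; apply: memvZ.
by rewrite -(scale1r t) -(mulVf k_neq0) -scalerA -Pk memvZ // memv_pick.
Qed.

(** [tangent] is defined through [vpick], whose value on [<[t]>] is an unspecified multiple of [t];
    this allows [t] itself to be used instead. *)
Lemma vpick_line (F : fieldType) (t : 'rV[F]_3) :
  t != 0 -> exists2 k, k != 0 & vpick <[t]> = k *: t.
Proof.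
move=> t_neq0; have /vlineP[k pk] := memv_pick <[t]>; exists k => //.
have : vpick <[t]> != 0 by rewrite vpick0 -dimv_eq0 dim_vline t_neq0.
by apply: contraNneq => k0; rewrite pk k0 scale0r.
Qed.

Lemma vlineZ (F : fieldType) k (t : 'rV[F]_3) :
  k != 0 -> <[k *: t]>%VS = <[t]>%VS.
Proof.
move=> k_neq0; apply/eqP; rewrite eqEsubv -!memvE memvZ ?memv_line //=.
by apply/vlineP; exists k^-1; rewrite scalerA mulVf ?scale1r.
Qed.

Lemma mem_tangent_line (F : fieldType) (C : conic F) (t w : 'rV[F]_3) :
  t != 0 -> (w \in tangent C <[t]>) = (dot (w *m C) t == 0).
Proof.
move=> t_neq0; rewrite mem_tangent; have [k k_neq0 ->] := vpick_line t_neq0.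
by rewrite dotC dotZl mulf_eq0 (negPf k_neq0) dotC.
Qed.

Lemma cross_neq0 (F : fieldType) (u v : 'rV[F]_3) :
  u != 0 -> v != 0 -> <[u]>%VS != <[v]>%VS -> cross u v != 0.
Proof.
move=> u_neq0 v_neq0; apply: contraNneq => /(cross_eq0 v_neq0)[k uk].
rewrite uk vlineZ //; apply: contraNneq u_neq0 => k0.
by rewrite uk k0 scale0r.
Qed.

Lemma conic_dotC (F : fieldType) (C : conic F) (u v : 'rV[F]_3) :
  dot (u *m C) v = dot (v *m C) u.
Proof. by rewrite dotC dot_mulmx conic_sym. Qed.

(** A nondegenerate conic contains no line: if [u] and [v] were conjugate, their polars would both
    be the line joining them, and invertibility of [C] would make [u] and [v] proportional. *)
Lemma conic_isotropic_neq0 (F : fieldType) (C : conic F) (u v : 'rV[F]_3) :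
  nondegenerate_conic C -> u != 0 -> v != 0 -> <[u]>%VS != <[v]>%VS ->
  dot (u *m C) u = 0 -> dot (v *m C) v = 0 -> dot (u *m C) v != 0.
Proof.
move=> C_unit u_neq0 v_neq0 uv qu qv; apply/eqP => quv.
have qvu : dot (v *m C) u = 0 by rewrite conic_dotC.
have uv_neq0 := cross_neq0 u_neq0 v_neq0 uv.
have [k uk] := orth_cross uv_neq0 qu quv.
have [l vl] := orth_cross uv_neq0 qvu qv.
have mulC_neq0 (w : 'rV_3) : w != 0 -> w *m C != 0.
  by apply: contraNneq => w0; rewrite -(mulmxK C_unit w) w0 mul0mx.
have k_neq0 : k != 0.
  by apply: contraNneq (mulC_neq0 _ u_neq0) => k0; rewrite uk k0 scale0r.
have l_neq0 : l != 0.
  by apply: contraNneq (mulC_neq0 _ v_neq0) => l0; rewrite vl l0 scale0r.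
move/eqP: uv; apply; rewrite -(vlineZ _ l_neq0) -[RHS](vlineZ _ k_neq0).
congr <[_]>%VS; apply: (can_inj (mulmxK C_unit)).
by rewrite -!scalemxAl uk vl !scalerA mulrC.
Qed.

(** * The projective frame formed by the four vertices *)

Definition mx3 (F : fieldType) (p q r : 'rV[F]_3) : 'M[F]_3 :=
  \matrix_i [:: p; q; r]`_i.

Lemma mul_mx3 (F : fieldType) (u p q r : 'rV[F]_3) :
  u *m mx3 p q r = u 0 0 *: p + u 0 1 *: q + u 0 2 *: r.
Proof. by rewrite mulmx_sum_row sum_ord3 !rowK. Qed.

(** Isotropy of [p], [q], [r] kills the diagonal of their Gram matrix, leaving a conic circumscribed
    about the coordinate triangle. *)
Lemma conic_mx3 (F : fieldType) (C : conic F) (p q r u v : 'rV[F]_3) :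
    dot (p *m C) p = 0 -> dot (q *m C) q = 0 -> dot (r *m C) r = 0 ->
  dot (u *m mx3 p q r *m C) (v *m mx3 p q r) =
    dot (q *m C) r * (u 0 1 * v 0 2 + u 0 2 * v 0 1)
    + dot (p *m C) r * (u 0 0 * v 0 2 + u 0 2 * v 0 0)
    + dot (p *m C) q * (u 0 0 * v 0 1 + u 0 1 * v 0 0).
Proof.
move=> pp qq rr; rewrite !mul_mx3 !mulmxDl -!scalemxAl !dotDl !dotZl.
rewrite ![dot (_ *m C) (_ + _)]dotC !dotDl !dotZl ![dot _ (_ *m C)]dotC.
rewrite pp qq rr [dot (q *m C) p]conic_dotC [dot (r *m C) p]conic_dotC.
by rewrite [dot (r *m C) q]conic_dotC; ring.
Qed.

(** The Gram matrix of [p], [q], [r] has zero diagonal, hence its determinant is twice the product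
    of the three mixed values, which is nonzero. *)
Lemma mx3_unit (F : fieldType) (C : conic F) (p q r : 'rV[F]_3) :
    2 != 0 :> F ->
    dot (p *m C) p = 0 -> dot (q *m C) q = 0 -> dot (r *m C) r = 0 ->
    dot (q *m C) r != 0 -> dot (p *m C) r != 0 -> dot (p *m C) q != 0 ->
  mx3 p q r \in unitmx.
Proof.
move=> two_neq0 pp qq rr qr pr pq; rewrite -row_free_unit.
apply: inj_row_free => u uP0.
have orth v : dot (u *m mx3 p q r *m C) (v *m mx3 p q r) = 0.
  by rewrite uP0 mul0mx dotE !mxE; ring.
have := orth (vec3 1 0 0); have := orth (vec3 0 1 0); have := orth (vec3 0 0 1).
rewrite !conic_mx3 // !vec3E !(mulr0, mulr1, addr0, add0r).
set a := dot (q *m C) r in qr *; set b := dot (p *m C) r in pr *.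
set c := dot (p *m C) q in pq * => e2 e1 e0.
have u0 : u 0 0 = 0.
  (* The combination of the three equations below eliminates the other two coordinates and leaves
     [2 * (b * c) * u 0 0]. *)
  apply: (mulfI (mulf_neq0 two_neq0 (mulf_neq0 pr pq))); rewrite mulr0.
  transitivity (c * (a * u 0 1 + b * u 0 0) + b * (a * u 0 2 + c * u 0 0)
                - a * (b * u 0 2 + c * u 0 1)); first by ring.
  by rewrite e0 e1 e2; ring.
move: e1 e2; rewrite u0 !mulr0 !addr0 => /eqP + /eqP.
rewrite !mulf_eq0 (negPf qr) /= => /eqP u2 /eqP u1.
by apply: vec3_ext; rewrite !mxE.
Qed.

(* Index 0 stands for the fourth vertex. *)
Definition frame_pt (F : fieldType) (i : 'Z_4) : 'rV[F]_3 :=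
  [:: vec3 1 1 1; vec3 1 0 0; vec3 0 1 0; vec3 0 0 1]`_i.

(* The polar form of the conic a yz + b xz + c xy = 0. *)
Definition circumconic (F : fieldType) (a b c : F) (u v : 'rV[F]_3) : F :=
  a * (u 0 1 * v 0 2 + u 0 2 * v 0 1) + b * (u 0 0 * v 0 2 + u 0 2 * v 0 0)
  + c * (u 0 0 * v 0 1 + u 0 1 * v 0 0).

Lemma Z4_cases (Q : 'Z_4 -> Prop) : Q 0 -> Q 1 -> Q 2 -> Q 3 -> forall i, Q i.
Proof.
by move=> Q0 Q1 Q2 Q3 [[|[|[|[|//]]]] lt_i4];
  [move: Q0|move: Q1|move: Q2|move: Q3]; congr Q; apply/val_inj.
Qed.

(** On the side x = 0 the form reduces to 2ayz, so the conic meets that side only at two vertices;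
    the last two hypotheses exclude these. *)
Lemma isotropic_coord_neq0 (F : fieldType) (a b c x y z : F) :
    2 != 0 :> F -> a * (y * z + z * y) + b * (x * z + z * x)
                   + c * (x * y + y * x) = 0 ->
  a * y + b * x != 0 -> a * z + c * x != 0 -> x != 0.
Proof.
move=> two_neq0 q0 y_neq0 z_neq0; apply: contra_eq_neq q0 => x0.
move: y_neq0 z_neq0; rewrite x0 !(mulr0, mul0r, addr0) => ay az.
have -> : a * (y * z + z * y) = 2 * (a * y) * z by ring.
rewrite mulf_neq0 ?(mulf_neq0 two_neq0 ay) //; apply: contraNneq az => ->.
by rewrite mulr0.
Qed.

Lemma inscribed_frame (F : fieldType) (C : conic F)
    (A : 'Z_4 -> {vspace 'rV[F]_3}) :
    2 != 0 :> F -> nondegenerate_conic C ->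
    (forall i, is_point (A i)) -> injective A -> (forall i, on_conic C (A i)) ->
  exists (P : 'M[F]_3) (a b c : F),
    [/\ P \in unitmx, [/\ a != 0, b != 0 & c != 0], a + b + c = 0,
        forall i, A i = <[frame_pt F i *m P]>%VS
      & forall u v, dot (u *m P *m C) (v *m P) = circumconic a b c u v].
Proof.
move=> two_neq0 C_unit A_point A_inj A_C.
pose q i := vpick (A i).
have q_neq0 i : q i != 0 by rewrite vpick0 -dimv_eq0 A_point.
have Aq i : A i = <[q i]>%VS.
  apply/eqP; rewrite eq_sym eqEdim dim_vline q_neq0 A_point leqnn.
  by rewrite -memvE memv_pick.
have qq i : dot (q i *m C) (q i) = 0 by apply: A_C; apply: memv_pick.
have qqN (i j : 'Z_4) : i != j -> dot (q i *m C) (q j) != 0.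
  move=> ij; apply: conic_isotropic_neq0 => //.
  by rewrite -!Aq (inj_eq A_inj).
have Q_unit : mx3 (q 1) (q 2) (q 3) \in unitmx.
  by apply: (mx3_unit (C := C)); rewrite ?qqN.
(* [y] holds the coordinates of the fourth vertex in the basis given by the other three; none of
   them vanishes, as shown below. *)
pose y := q 0 *m invmx (mx3 (q 1) (q 2) (q 3)).
have q0E : q 0 = y *m mx3 (q 1) (q 2) (q 3) by rewrite mulmxKV.
have q1E : q 1 = vec3 1 0 0 *m mx3 (q 1) (q 2) (q 3).
  by rewrite mul_mx3 !vec3E scale1r !scale0r !addr0.
have q2E : q 2 = vec3 0 1 0 *m mx3 (q 1) (q 2) (q 3).
  by rewrite mul_mx3 !vec3E scale1r !scale0r addr0 add0r.
have q3E : q 3 = vec3 0 0 1 *m mx3 (q 1) (q 2) (q 3).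
  by rewrite mul_mx3 !vec3E scale1r !scale0r !add0r.
have q0qN (i : 'Z_4) v : 0 != i -> q i = v *m mx3 (q 1) (q 2) (q 3) ->
    circumconic (dot (q 2 *m C) (q 3)) (dot (q 1 *m C) (q 3))
      (dot (q 1 *m C) (q 2)) y v != 0.
  by move=> i0 qi; rewrite /circumconic -conic_mx3 // -q0E -qi qqN.
have := q0qN 1 _ isT q1E; have := q0qN 2 _ isT q2E; have := q0qN 3 _ isT q3E.
have := qq 0; rewrite {1 2}q0E conic_mx3 //.
have := qqN 1 2 isT; have := qqN 1 3 isT; have := qqN 2 3 isT.
rewrite /circumconic !vec3E !(mulr0, mulr1, addr0, add0r).
set a := dot (q 2 *m C) (q 3); set b := dot (q 1 *m C) (q 3).
set c := dot (q 1 *m C) (q 2) => a0 b0 c0 qq0 n3 n2 n1.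
have y0 : y 0 0 != 0.
  exact: (@isotropic_coord_neq0 _ a b c _ (y 0 1) (y 0 2)).
have y1 : y 0 1 != 0.
  apply: (@isotropic_coord_neq0 _ b a c _ (y 0 0) (y 0 2)) => //.
  - by rewrite -[RHS]qq0; ring.
  - by rewrite addrC.
have y2 : y 0 2 != 0.
  apply: (@isotropic_coord_neq0 _ c a b _ (y 0 0) (y 0 1)) => //.
  - by rewrite -[RHS]qq0; ring.
  - by rewrite addrC.
  - by rewrite addrC.
(* Scaling the basis vectors by the coordinates of [q 0] turns the fourth vertex into the unit point
   (1:1:1). *)
pose P := mx3 (y 0 0 *: q 1) (y 0 1 *: q 2) (y 0 2 *: q 3).
have isoZ k i : dot (k *: q i *m C) (k *: q i) = 0.
  by rewrite -scalemxAl dotZl dotC dotZl dotC qq !mulr0.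
have dotZZ k l i j :
    dot (k *: q i *m C) (l *: q j) = k * l * dot (q i *m C) (q j).
  by rewrite -scalemxAl dotZl dotC dotZl dotC mulrA.
have P_unit : P \in unitmx.
  by apply: (mx3_unit (C := C)); rewrite ?isoZ // dotZZ !mulf_neq0.
have q0P : q 0 = vec3 1 1 1 *m P.
  by rewrite mul_mx3 !vec3E !scale1r {1}q0E mul_mx3.
(* Each coefficient is the polar value of two rescaled basis vectors, so it picks up both of their
   scale factors. *)
exists P, (y 0 1 * y 0 2 * a), (y 0 0 * y 0 2 * b), (y 0 0 * y 0 1 * c).
split=> //.
- by rewrite !mulf_neq0.
(* Twice the sum of the coefficients is the value of the form at [q 0], which lies on the conic. *)
- apply: (mulfI two_neq0); rewrite mulr0 -[RHS]qq0; ring.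
- elim/Z4_cases; rewrite Aq.
  + by rewrite q0P.
  + by rewrite mul_mx3 !vec3E scale1r !scale0r !addr0 vlineZ.
  + by rewrite mul_mx3 !vec3E scale1r !scale0r addr0 add0r vlineZ.
  + by rewrite mul_mx3 !vec3E scale1r !scale0r !add0r vlineZ.
- by move=> u v; rewrite conic_mx3 // !dotZZ.
Qed.

(** * The points X_i and T_i in the frame, and the dual conic *)

Lemma line_tangent_point (F : fieldType) (C : conic F)
    (u v w : 'rV[F]_3) (S : {vspace 'rV[F]_3}) :
    w != 0 -> dot (u *m C) w != 0 ->
    intersection_point (line_through <[u]> <[v]>) (tangent C <[w]>) S ->
  S = <[dot (v *m C) w *: u - dot (u *m C) w *: v]>%VS.
Proof.
move=> w_neq0 uw S_def; apply: intersection_point_line S_def _ => x.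
move=> /memv_addP[_ /vlineP[k ->] [_ /vlineP[l ->] ->]].
rewrite mem_tangent_line // mulmxDl -!scalemxAl dotDl !dotZl => /eqP kl0.
(* Conjugacy to [w] expresses [k] through [l], since [dot (u *m C) w] is nonzero. *)
exists (- l / dot (u *m C) w).
rewrite scalerBr !scalerA mulfVK // scaleNr opprK; congr (_ *: _ + _).
apply: (mulIf uw); rewrite (canRL (addrK _) kl0); by field.
Qed.

(* Solution of the linear system expressing that the eight lines of
   [dual_mx_side] belong to a dual conic, doubled to avoid halving the off-diagonal entries. *)
Definition dual_mx (F : fieldType) (a b : F) : 'M[F]_3 :=
  let xx := - (a ^+ 2 * b * (2 * b + a)) in
  let yy := a ^+ 4 + 2 * a ^+ 3 * b + a ^+ 2 * b ^+ 2 - b ^+ 4 in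
  let zz := - (b * (a + b) ^+ 2 * (b - a)) in
  let xy := a ^+ 4 - 2 * a ^+ 2 * b ^+ 2 + a * b ^+ 3 in
  let yz := a ^+ 4 + 4 * a ^+ 3 * b + 4 * a ^+ 2 * b ^+ 2 - a * b ^+ 3
            - 2 * b ^+ 4 in
  let xz := - (a ^+ 4 + 2 * a ^+ 3 * b + 2 * a ^+ 2 * b ^+ 2 + a * b ^+ 3) in
  mx3 (vec3 (2 * xx) xy xz) (vec3 xy (2 * yy) yz) (vec3 xz yz (2 * zz)).

Lemma dual_mx_sym (F : fieldType) (a b : F) : (dual_mx a b)^T = dual_mx a b.
Proof.
by apply/matrixP; elim/ord3_cases; elim/ord3_cases; rewrite !mxE /= ?mxE.
Qed.

(** Two diagonal entries suffice: the first vanishes only if a = -2b, and then the last is, up to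
    sign, 6 times the fourth power of b. *)
Lemma dual_mx_neq0 (F : fieldType) (a b : F) :
  2 != 0 :> F -> 3 != 0 :> F -> a != 0 -> b != 0 -> dual_mx a b != 0.
Proof.
move=> two_neq0 three_neq0 a_neq0 b_neq0; apply/eqP => /matrixP D0.
have := D0 0 0; have := D0 2 2; rewrite !mxE /= ?mxE /= => zz0 xx0.
have ab : a = - 2 * b.
  apply/eqP; rewrite -subr_eq0; apply/eqP; apply: (mulfI two_neq0).
  apply: (mulfI (mulf_neq0 (expf_neq0 2 a_neq0) b_neq0)).
  rewrite !mulr0 -[RHS]oppr0 -[in RHS]xx0; ring.
have /eqP : 2 * 3 * b ^+ 4 = 0 by rewrite -[RHS]oppr0 -[in RHS]zz0 ab; ring.
by apply/negP; rewrite !mulf_neq0 ?expf_neq0.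
Qed.

(* The intersection of the tangent at A_i with the side A_(i+m) A_(i+m+1),
   that is X_i for m = 1 and T_i for m = 2. *)
Definition tangent_side_pt (F : fieldType) (a b c : F) (m i : 'Z_4) :
    'rV[F]_3 :=
  circumconic a b c (frame_pt F (i + (m + 1))) (frame_pt F i)
    *: frame_pt F (i + m)
  - circumconic a b c (frame_pt F (i + m)) (frame_pt F i)
    *: frame_pt F (i + (m + 1)).

Lemma vec3Z (F : fieldType) (k x y z : F) :
  k *: vec3 x y z = vec3 (k * x) (k * y) (k * z).
Proof. by apply: vec3_ext; rewrite !mxE. Qed.

Lemma vec3D (F : fieldType) (x y z x' y' z' : F) :
  vec3 x y z + vec3 x' y' z' = vec3 (x + x') (y + y') (z + z').
Proof. by apply: vec3_ext; rewrite !mxE. Qed.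

Lemma vec3B (F : fieldType) (x y z x' y' z' : F) :
  vec3 x y z - vec3 x' y' z' = vec3 (x - x') (y - y') (z - z').
Proof. by apply: vec3_ext; rewrite !mxE. Qed.

Lemma cross_vec3 (F : fieldType) (x y z x' y' z' : F) :
  cross (vec3 x y z) (vec3 x' y' z')
  = vec3 (y * z' - z * y') (z * x' - x * z') (x * y' - y * x').
Proof. by rewrite /cross !vec3E. Qed.

Lemma circumconic_vec3 (F : fieldType) (a b c x y z x' y' z' : F) :
  circumconic a b c (vec3 x y z) (vec3 x' y' z')
  = a * (y * z' + z * y') + b * (x * z' + z * x') + c * (x * y' + y * x').
Proof. by rewrite /circumconic !vec3E. Qed.

(** [n] is the coordinate vector of T_i T_(i+1) or X_i X_(i+1). With c replaced by -a-b, each of the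
    eight cases is a polynomial identity in [a] and [b]. *)
Lemma dual_mx_side (F : fieldType) (a b : F) (m i : 'Z_4) :
    m = 1 \/ m = 2 ->
  let t := tangent_side_pt a b (- a - b) m in
  let n := cross (t i) (t (i + 1)) in
  dot (n *m dual_mx a b) n = 0.
Proof.
rewrite /= /tangent_side_pt.
case=> ->; elim/Z4_cases: i; rewrite /frame_pt /= !circumconic_vec3.
all: rewrite !(mulr0, mulr1, mul0r, addr0, add0r) !vec3Z !vec3B cross_vec3.
all: rewrite !(oppr0, mulr0, mulr1, mul0r, addr0, add0r, subr0, sub0r).
all: rewrite mul_mx3 !vec3E !vec3Z !vec3D dotE !vec3E.
all: ring.
Qed.

(** * Index arithmetic modulo 4 and 8 *)

Lemma double8S (i : 'Z_4) : double8 (i + 1) = double8 i + 2.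
Proof. by elim/Z4_cases: i; apply/val_inj. Qed.

Lemma double8_cases (k : 'Z_8) : exists i, k = double8 i - 1 \/ k = double8 i.
Proof.
case: k => [[|[|[|[|[|[|[|[|//]]]]]]]] lt_k8].
- by exists 0; right; apply/val_inj.
- by exists 1; left; apply/val_inj.
- by exists 1; right; apply/val_inj.
- by exists 2; left; apply/val_inj.
- by exists 2; right; apply/val_inj.
- by exists 3; left; apply/val_inj.
- by exists 3; right; apply/val_inj.
- by exists 0; left; apply/val_inj.
Qed.

Lemma intersection_point_sub (F : fieldType) (L M P : {vspace 'rV[F]_3}) :
  intersection_point L M P -> (P <= L)%VS /\ (P <= M)%VS.
Proof. by case=> _ _ _ ->; rewrite capvSl capvSr. Qed.

Lemma double8_add1 (i : 'Z_4) : double8 i + 1 = double8 (i + 1) - 1.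
Proof. by elim/Z4_cases: i; apply/val_inj. Qed.

Lemma Z4_add1B2 (i : 'Z_4) : i + 1 - 2 = i - 1.
Proof. by elim/Z4_cases: i; apply/val_inj. Qed.

Lemma Z4_addr_neq (i m : 'Z_4) : m != 0 -> i + m != i.
Proof. by rewrite -[X in _ + _ != X]addr0 (inj_eq (addrI i)). Qed.

(** * From the frame back to the given conics *)

Lemma side_pt_line (F : fieldType) (C : conic F) (P : 'M[F]_3) (a b c : F)
    (A S : 'Z_4 -> {vspace 'rV[F]_3}) (m : 'Z_4) :
    nondegenerate_conic C -> (forall i, is_point (A i)) -> injective A ->
    (forall i, on_conic C (A i)) ->
    (forall i, A i = <[frame_pt F i *m P]>%VS) ->
    (forall u v, dot (u *m P *m C) (v *m P) = circumconic a b c u v) ->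
    m != 0 ->
    (forall i, intersection_point
       (line_through (A (i + m)) (A (i + (m + 1)))) (tangent C (A i)) (S i)) ->
  forall i, S i = <[tangent_side_pt a b c m i *m P]>%VS.
Proof.
move=> C_unit A_point A_inj A_C A_P CE m_neq0 S_def i.
have fP_neq0 j : frame_pt F j *m P != 0.
  apply/eqP => fP0; have := A_point j.
  by rewrite /is_point A_P fP0 dim_vline eqxx.
have fP_iso j : dot (frame_pt F j *m P *m C) (frame_pt F j *m P) = 0.
  by apply: (A_C j); rewrite A_P memv_line.
have := S_def i; rewrite !A_P => /line_tangent_point -> //.
  by rewrite !CE /tangent_side_pt mulmxBl !scalemxAl.
(* Since [m] is nonzero, A_(i+m) and A_i are distinct points of [C], hence not conjugate. *)
apply: conic_isotropic_neq0 => //.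
by rewrite -!A_P (inj_eq A_inj) Z4_addr_neq.
Qed.

(** [v *m C *m P^T] is the polar of [v], written in frame coordinates. By reciprocity it passes
    through both points of contact, so it is their join. *)
Lemma tangents_meet (F : fieldType) (C : conic F) (P : 'M[F]_3)
    (s t v : 'rV[F]_3) :
    s *m P != 0 -> t *m P != 0 -> <[s *m P]>%VS != <[t *m P]>%VS ->
    v \in tangent C <[s *m P]> -> v \in tangent C <[t *m P]> ->
  exists k, v *m C *m P^T = k *: cross s t.
Proof.
move=> sP_neq0 tP_neq0 st; rewrite !mem_tangent_line // !dot_mulmx.
move=> /eqP vs /eqP vt; apply: orth_cross => //; apply: cross_neq0.
- by apply: contraNneq sP_neq0 => ->; rewrite mul0mx.
- by apply: contraNneq tP_neq0 => ->; rewrite mul0mx.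
apply: contra_neq st => st; apply/eqP; rewrite eqEdim !dim_vline sP_neq0 tP_neq0.
have /vlineP[k ->] : s \in <[t]>%VS by rewrite -st memv_line.
by rewrite -scalemxAl -memvE memvZ ?memv_line.
Qed.

Theorem theorem4p2 (R : realType) (C C1 : conic R[i])
    (A T X : 'Z_4 -> {vspace 'rV[R[i]]_3})
    (J K : 'Z_8 -> {vspace 'rV[R[i]]_3})
    (C_nondegenerate : nondegenerate_conic C)
    (A_point : forall i, is_point (A i))
    (A_distinct : injective A)
    (A_on_C : forall i, on_conic C (A i))
    (T_def : forall i : 'Z_4,
       intersection_point (line_through (A (i + 2)) (A (i + 3))) (tangent C (A i))
         (T i))
    (X_def : forall i : 'Z_4,
       intersection_point (line_through (A (i + 1)) (A (i + 2))) (tangent C (A i))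
         (X i))
    (T_distinct : injective T)
    (X_distinct : injective X)
    (X_neq_T : forall i j, X i != T j)
    (C1_nondegenerate : nondegenerate_conic C1)
    (X_on_C1 : forall i, on_conic C1 (X i))
    (T_on_C1 : forall i, on_conic C1 (T i))
    (J_odd_def : forall i : 'Z_4,
       intersection_point (tangent C1 (X (i - 2))) (tangent C1 (T i))
         (J (double8 i - 1)))
    (J_even_def : forall i : 'Z_4,
       intersection_point (tangent C1 (X (i - 1))) (tangent C1 (T i))
         (J (double8 i)))
    (K_def : forall i : 'Z_8,
       intersection_point (line_through (J i) (J (i + 1)))
         (line_through (J (i + 2)) (J (i + 3))) (K i)) :
  exists C2 : conic R[i], forall i : 'Z_8, on_conic C2 (K i).
Proof.
have two_neq0 : 2 != 0 :> R[i] by rewrite Num.Theory.pnatr_eq0.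
have three_neq0 : 3 != 0 :> R[i] by rewrite Num.Theory.pnatr_eq0.
have [P [a [b [c [P_unit [a_neq0 b_neq0 _] abc A_P CE]]]]] :=
  inscribed_frame two_neq0 C_nondegenerate A_point A_distinct A_on_C.
have {abc}cE : c = - a - b by rewrite -[c](addKr (a + b)) addrC abc; ring.
rewrite {}cE in CE.
have T_P : forall i, T i = <[tangent_side_pt a b (- a - b) 2 i *m P]>%VS.
  apply: (side_pt_line C_nondegenerate A_point A_distinct A_on_C A_P CE
    (isT : (2 : 'Z_4) != 0)).
  have -> : 2 + 1 = 3 :> 'Z_4 by apply/val_inj.
  exact: T_def.
have X_P : forall i, X i = <[tangent_side_pt a b (- a - b) 1 i *m P]>%VS.
  apply: (side_pt_line C_nondegenerate A_point A_distinct A_on_C A_P CE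
    (isT : (1 : 'Z_4) != 0)).
  have -> : 1 + 1 = 2 :> 'Z_4 by apply/val_inj.
  exact: X_def.
(* Pullback of the dual conic under the map sending a point to its polar with respect to [C1], in
   frame coordinates. *)
pose M := C1 *m P^T *m dual_mx a b *m (P *m C1).
have M_sym : M^T = M.
  by rewrite /M !trmx_mul trmxK dual_mx_sym conic_sym !mulmxA.
have M_neq0 : M != 0.
  apply: contraNneq (dual_mx_neq0 two_neq0 three_neq0 a_neq0 b_neq0) => M0.
  have U_unit : P *m C1 \in unitmx by rewrite unitmx_mul P_unit.
  have V_unit : C1 *m P^T \in unitmx by rewrite unitmx_mul unitmx_tr P_unit andbT.
  rewrite -(mulKmx V_unit (dual_mx a b)).
  by rewrite -(mulmxK U_unit (_ *m dual_mx a b)) -/M M0 mul0mx mulmx0.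
exists (Conic M_sym M_neq0).
(* Treats both families at once: [S] is [T] with [m = 2], or [X] with [m = 1]. *)
have on_C2 (S : 'Z_4 -> {vspace 'rV[R[i]]_3}) m i v : m = 1 \/ m = 2 ->
    (forall i, S i = <[tangent_side_pt a b (- a - b) m i *m P]>%VS) ->
    (forall i, S i != 0%VS) -> injective S ->
    v \in tangent C1 (S i) -> v \in tangent C1 (S (i + 1)) ->
  quad_form (Conic M_sym M_neq0) v = 0.
  move=> m12 S_P S_neq0 S_inj.
  have tP_neq0 j : tangent_side_pt a b (- a - b) m j *m P != 0.
    apply: contraNneq (S_neq0 j) => tP0; rewrite S_P tP0.
    by rewrite -dimv_eq0 dim_vline eqxx.
  have S_neq : S i != S (i + 1).
    apply: contra_neq (Z4_addr_neq i (isT : (1 : 'Z_4) != 0)) => SS.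
    exact/esym/S_inj.
  move: S_neq; rewrite !S_P => S_neq vS vS1.
  have [k yk] := tangents_meet (tP_neq0 i) (tP_neq0 (i + 1)) S_neq vS vS1.
  have -> : quad_form (Conic M_sym M_neq0) v
            = dot (v *m C1 *m P^T *m dual_mx a b) (v *m C1 *m P^T).
    by rewrite /quad_form /dot /= !trmx_mul trmxK conic_sym !mulmxA.
  rewrite yk -scalemxAl dotZl dotC dotZl dotC.
  by have := @dual_mx_side _ a b m i m12; rewrite /= => ->; rewrite !mulr0.
have line_T i : (line_through (J (double8 i - 1)) (J (double8 i))
                 <= tangent C1 (T i))%VS.
  have [_ Jo] := intersection_point_sub (J_odd_def i).
  have [_ Je] := intersection_point_sub (J_even_def i).
  by rewrite /line_through subv_add; apply/andP.
have line_X i : (line_through (J (double8 i)) (J (double8 i + 1)%R)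
                 <= tangent C1 (X (i - 1)))%VS.
  have [Jo _] := intersection_point_sub (J_odd_def (i + 1)).
  have [Je _] := intersection_point_sub (J_even_def i).
  (* J_(2i+1) is the odd point of index i+1, whose tangent at X_(i+1-2) is the one at X_(i-1). *)
  rewrite Z4_add1B2 -double8_add1 in Jo.
  by rewrite /line_through subv_add; apply/andP.
move=> k v; have [_ _ _ ->] := K_def k; rewrite memv_cap => /andP[].
have [i [->|->]] := double8_cases k.
(* K_(2i-1) lies on the tangents at T_i and T_(i+1). *)
- rewrite subrK.
  have -> : double8 i - 1 + 2 = double8 (i + 1) - 1 by rewrite double8S addrAC.
  have -> : double8 i - 1 + 3 = double8 (i + 1).
    by rewrite double8S -addrA; congr (_ + _); apply/val_inj.
  move=> /(subvP (line_T i)) vT /(subvP (line_T (i + 1))) vT1.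
  have T_neq0 j := intersection_point_neq0 (T_def j).
  exact: (on_C2 T 2 i v (or_intror erefl) T_P T_neq0 T_distinct vT vT1).
(* K_(2i) lies on the tangents at X_(i-1) and X_i, so [on_C2] is applied at i-1. *)
- have -> : double8 i + 2 = double8 (i + 1) by rewrite double8S.
  have -> : double8 i + 3 = double8 (i + 1) + 1.
    by rewrite double8S -addrA; congr (_ + _); apply/val_inj.
  move=> /(subvP (line_X i)) vX /(subvP (line_X (i + 1))); rewrite addrAC => vX1.
  have X_neq0 j := intersection_point_neq0 (X_def j).
  exact: (on_C2 X 1 (i - 1) v (or_introl erefl) X_P X_neq0 X_distinct vX vX1).
Qed.
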